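(* Let $R$ be a reduced extended affine root system in $\mathcal V$ with extended affine Weyl group $\mathcal W$, and let $\emptyset\ne P\subseteq R^\times$ be connected. Put $R_P^n:=\mathcal W_PP$, $R_P^i:=(R_P^n-R_P^n)\cap R^0$ and $R_P:=R_P^n\cup R_P^i$. (i) The set $R_P$ is an extended affine root system in $\mathcal V_P:=\mathrm{span}_{\mathbb R}R_P$ satisfying $R_P^\times=R_P^n$, $R_P^0=R_P^i$ and $\mathcal W_P=\mathcal W_{R_P}$, where $\mathcal W_{R_P}$ is the subgroup of $\mathcal W$ generated by $w_\alpha$, $\alpha\in R_P^\times$. (ii) If $\mathcal W=\mathcal W_P$, then $R_P$ has the same rank, nullity and type as $R$. In particular, if $P$ belongs to either of the classes $\mathcal M_c$ or $\mathcal M_m$, then $R_P$ has the same rank, nullity and type as $R$. (iii) If $P$ is a reflectable set, then $R_P=R$.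
   Context: All vector spaces are finite-dimensional and real. Let $\mathcal V$ be a vector space with a positive semidefinite symmetric bilinear form $(\cdot,\cdot)$ with radical $\mathcal V^0$. For $R\subseteq\mathcal V$ put $R^0=R\cap\mathcal V^0$, $R^\times=R\setminus R^0$. For $(\alpha,\alpha)\ne0$ put $\alpha^\vee=2\alpha/(\alpha,\alpha)$, $w_\alpha(\beta)=\beta-(\beta,\alpha^\vee)\alpha$. $\langle A\rangle$ is the additive subgroup generated by $A$. $P\subseteq\mathcal V\setminus\mathcal V^0$ is connected if it is not a disjoint union of nonempty $P_1,P_2$ with $(P_1,P_2)=\{0\}$. $R$ is an extended affine root system in $\mathcal V$ if: $\langle R\rangle$ is a full lattice in $\mathcal V$; $(\beta,\alpha^\vee)\in\mathbb Z$ for $\alpha,\beta\in R^\times$; $w_\alpha(\beta)\in R$ for $\alpha\in R^\times,\beta\in R$; $R^0=\mathcal V^0\cap(R^\times-R^\times)$; $\alpha\in R^\times\Rightarrow2\alpha\notin R$; $R^\times$ is connected. In particular $R^\times\ne\emptyset$. (For $R_P$, the form on $\mathcal V_P$ is the restriction of that of $\mathcal V$.) The nullity of $R$ is $\dim\mathcal V^0$. The image $\bar R$ of $R$ in $\mathcal V/\mathcal V^0$ is an irreducible finite root system (containing $0$); the type and rank of $R$ are those of $\bar R$; $R$ is reduced if $\bar R$ is. Weyl group: there is a finite root system $\dot R\subseteq R$ mapping isometrically onto $\bar R$ with $\mathcal V=\dot{\mathcal V}\oplus\mathcal V^0$, $\dot{\mathcal V}=\mathrm{span}\,\dot R$. Put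 $\tilde{\mathcal V}=\dot{\mathcal V}\oplus\mathcal V^0\oplus(\mathcal V^0)^*$ and extend the form by $(\dot{\mathcal V},(\mathcal V^0)^* )=((\mathcal V^0)^*,(\mathcal V^0)^* )=\{0\}$, $(\sigma,\lambda)=\lambda(\sigma)$. $\mathcal W\le GL(\tilde{\mathcal V})$ is generated by $w_\alpha:\beta\mapsto\beta-(\beta,\alpha^\vee)\alpha$, $\alpha\in R^\times$; $\mathcal W_P$ is the subgroup generated by $w_\alpha$, $\alpha\in P$. $P\subseteq R^\times$ is a reflectable set if $\mathcal W_PP=R^\times$. $\mathcal M_m$ is the class of $P\subseteq R^\times$ minimal under inclusion with respect to $\mathcal W_P=\mathcal W$. $\mathcal M_c$ is the class of $P\subseteq R^\times$ with $\mathcal W_P=\mathcal W$ and $|P|=c$, where $c$ is the least number of reflections $w_\alpha$ ($\alpha\in R^\times$) generating $\mathcal W$. *)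

(* Defs.v *)
From HB Require Import structures.
From mathcomp Require Import all_boot all_order all_algebra.
From mathcomp Require Import sesquilinear ring.
From mathcomp Require Import boolp classical_sets functions cardinality reals.

Set Implicit Arguments.
Unset Strict Implicit.
Unset Printing Implicit Defensive.

Import Order.TTheory GRing.Theory Num.Theory.

Local Open Scope classical_set_scope.
Local Open Scope ring_scope.

(** * Spans of arbitrary sets *)

(* [<<_>>%VS] only takes finite sequences, whereas root systems may be infinite:
   [vspan A] is the least subspace containing [A] (see [mem_vspan]). *)
Definition vspan (K : fieldType) (V : vectType K) (A : set V) : {vspace V} :=
  xget fullv [set U : {vspace V} | A `<=` [set x | x \in U] /\
    forall W : {vspace V}, A `<=` [set x | x \in W] -> (U <= W)%VS].

Section Vspan.
Variables (K : fieldType) (V : vectType K).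

Let seq_in (A : set V) (s : seq V) := forall x, x \in s -> A x.

Let max_seq (A : set V) : exists2 s, seq_in A s &
  forall x, A x -> x \in <<s>>%VS.
Proof.
suff H n : forall s, seq_in A s -> (\dim {:V} - \dim <<s>> <= n)%N ->
    exists2 s, seq_in A s & forall x, A x -> x \in <<s>>%VS.
  by apply: (H (\dim {:V} - \dim <<[::] : seq V>>)%N [::]).
elim: n => [|n IHn] s As.
  rewrite leqn0 subn_eq0 => le_s; exists s => // x _.
  suff -> : <<s>>%VS = {:V}%VS by exact: memvf.
  by apply/eqP; rewrite eqEdim subvf.
move=> le_n; have [sP|] := pselect (forall x, A x -> x \in <<s>>%VS).
  by exists s.
move=> /existsNP[x /not_implyP[Ax /negP xNs]].
apply: (IHn (x :: s)).
  by move=> y; rewrite inE => /predU1P[->//|]; exact: As.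
have lt_s : (\dim <<s>> < \dim <<x :: s>>)%N.
  rewrite ltn_neqAle dimvS ?andbT; last first.
    by rewrite span_cons; exact: addvSr.
  apply: contra xNs => /eqP eq_dim.
  have /eqP-> : <<s>>%VS == <<x :: s>>%VS.
    by rewrite eqEdim eq_dim leqnn andbT span_cons addvSr.
  by rewrite memv_span // mem_head.
have := dimvS (subvf <<x :: s>>%VS); move: lt_s le_n.
move: (\dim <<s>>)%N (\dim <<x :: s>>)%N (\dim {:V}) => a b c.
move=> lt_ab le_ac le_bc; rewrite -ltnS; apply: leq_trans le_ac.
by rewrite ltn_sub2l // (leq_trans lt_ab).
Qed.

Lemma vspanP (A : set V) : A `<=` [set x | x \in vspan A] /\
  forall W : {vspace V}, A `<=` [set x | x \in W] -> (vspan A <= W)%VS.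
Proof.
have [s As sA] := max_seq A.
apply: (@xgetPex _ fullv [set U : {vspace V} | A `<=` [set x | x \in U] /\
    forall W : {vspace V}, A `<=` [set x | x \in W] -> (U <= W)%VS]).
exists <<s>>%VS; split => [x /sA //|W AW].
by apply/span_subvP => x /As /AW.
Qed.

Lemma mem_vspan (A : set V) x : x \in vspan A <->
  exists2 s : seq V, (forall y, y \in s -> A y) & x \in <<s>>%VS.
Proof.
have [s As sA] := max_seq A; have [vA Av] := vspanP A; split.
  by move=> xA; exists s => //; move: xA; apply/subvP/Av => y /sA.
by case=> t At; apply/subvP/span_subvP => y /At /vA.
Qed.

End Vspan.

(** * Lattices *)

Definition additive_subgroup (V : zmodType) (A : set V) : Prop :=
  A 0 /\ forall x y, A x -> A y -> A (x - y).

Definition zspan (V : zmodType) (A : set V) : set V :=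
  smallest (@additive_subgroup V) A.

Definition full_lattice (K : fieldType) (V : vectType K) (L : set V) : Prop :=
  exists2 b : seq V, basis_of {:V} b & L = zspan [set x | x \in b].

(** * Reflections *)

Definition coroot (K : fieldType) (V : lmodType K) (f : V -> V -> K) (a : V)
  : V := (2 / f a a) *: a.

Definition refl (K : fieldType) (V : lmodType K) (f : V -> V -> K) (a b : V)
  : V := b - f b (coroot f a) *: a.

(** * Restricted forms, radical, quotient by the radical *)

Section Forms.
Variables (K : fieldType) (V : vectType K).

Definition restr_form (f : V -> V -> K) (U : {vspace V}) (x y : subvs_of U)
  : K := f (vsval x) (vsval y).

Variable f : {symmetric V}.

Section RestrForm.
Variable U : {vspace V}.

Fact restr_form_bilinear : @bilinear_for K (subvs_of U) (subvs_of U) K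
  *%R (idfun \; *%R) (@restr_form f U).
Proof.
split=> [y|x] a u v; rewrite /restr_form linearP ?linearPl ?linearPr //.
Qed.

HB.instance Definition _ := bilinear_isBilinear.Build K (subvs_of U)
  (subvs_of U) K *%R (idfun \; *%R) (@restr_form f U) restr_form_bilinear.

Fact restr_form_sym (x y : subvs_of U) :
  restr_form f x y = (-1) ^+ false * idfun (restr_form f y x).
Proof. exact: hermitian_subproof. Qed.

HB.instance Definition _ := isHermitianSesquilinear.Build K (subvs_of U)
  false idfun (@restr_form f U) restr_form_sym.

End RestrForm.

Definition radical : {vspace V} := orthov f {:V}.

Lemma mem_radical x : x \in radical <-> forall y, f x y = 0.
Proof.
split=> [/mem_orthovP fx y|fx]; first by apply: fx; exact: memvf.
by apply/mem_orthovP => y _.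
Qed.

(* The quotient of [V] by its radical, realized on a complement of the radical;
   [quo] is the canonical projection (see [quo_eq], [quo_surj]) and [quo_form]
   the induced form (see [quo_formE]). *)
Definition quoV : vectType K := subvs_of (radical^C)%VS.

Definition quo (x : V) : quoV :=
  vsproj (radical^C)%VS (daddv_pi (radical^C)%VS radical x).

Definition quo_form : {symmetric quoV} := @restr_form f (radical^C)%VS.

Let quo_add x : vsval (quo x) + daddv_pi radical (radical^C)%VS x = x.
Proof.
rewrite vsprojK ?memv_pi // daddv_pi_add //.
  by rewrite capvC capv_compl.
by rewrite addvC addv_complf memvf.
Qed.

Lemma quo_eq x y : quo x = quo y <-> x - y \in radical.
Proof.
split=> [eq_xy|xy].
  rewrite -[x]quo_add -[y]quo_add eq_xy opprD addrACA subrr add0r.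
  by rewrite memvB // memv_pi.
apply: (@subvs_inj _ _ (radical^C)%VS); rewrite /quo !vsprojK ?memv_pi //; apply/eqP.
rewrite -subr_eq0 -linearB /=; set z := x - y in xy *.
rewrite -(inj_eq (@addIr _ (daddv_pi radical (radical^C)%VS z))) add0r.
rewrite daddv_pi_add; first by rewrite daddv_pi_id // capv_compl.
  by rewrite capvC capv_compl.
by rewrite addvC addv_complf memvf.
Qed.

Lemma quo_surj (u : quoV) : exists x, quo x = u.
Proof.
exists (vsval u); rewrite /quo daddv_pi_id ?subvsP ?vsvalK //.
by rewrite capvC capv_compl.
Qed.

Lemma quo_formE x y : quo_form (quo x) (quo y) = f x y.
Proof.
rewrite -[x in RHS]quo_add -[y in RHS]quo_add linearDl !linearDr /=.
have rl u v : u \in radical -> f u v = 0 by move=> /mem_radical.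
have rr u v : v \in radical -> f u v = 0.
  by move=> /rl fv; rewrite hermC fv raddf0 mulr0.
by rewrite !(rl (daddv_pi _ _ _)) ?memv_pi // (rr _ (daddv_pi _ _ _))
  ?memv_pi // !addr0.
Qed.

End Forms.


(** * Root systems *)

Section RootSystems.
Variables (K : realType) (V : vectType K) (f : {symmetric V}).

Definition isotropic (R : set V) : set V := R `&` [set x | x \in radical f].

Definition nonisotropic (R : set V) : set V := R `\` [set x | x \in radical f].

Definition form_connected (P : set V) : Prop :=
  ~ exists P1 P2 : set V, [/\ P1 !=set0, P2 !=set0, P = P1 `|` P2,
    P1 `&` P2 = set0 & forall x y, P1 x -> P2 y -> f x y = 0].

Record is_ears (R : set V) : Prop := IsEars {
  ears_psd : forall x, 0 <= f x x;
  ears_lattice : full_lattice (zspan R);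
  ears_int : forall a b, nonisotropic R a -> nonisotropic R b ->
    f b (coroot f a) \is a Num.int;
  ears_refl : forall a b, nonisotropic R a -> R b -> R (refl f a b);
  ears_isotropic : isotropic R = [set x | x \in radical f] `&`
    [set a - b | a in nonisotropic R & b in nonisotropic R];
  ears_double : forall a, nonisotropic R a -> ~ R (2 *: a);
  ears_connected : form_connected (nonisotropic R);
  ears_nonempty : nonisotropic R !=set0 }.

(* Root systems contain 0; the ambient space of [S] is its span, on which [f]
   is definite. *)
Record finite_root_system (S : set V) : Prop := FiniteRootSystem {
  frs_finite : finite_set S;
  frs_zero : S 0;
  frs_definite : forall x, x \in vspan S -> x != 0 -> 0 < f x x;
  frs_int : forall a b, S a -> a != 0 -> S b ->
    f b (coroot f a) \is a Num.int;
  frs_refl : forall a b, S a -> a != 0 -> S b -> S (refl f a b) }.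

Definition nullity : nat := \dim (radical f).

Definition ears_bar (R : set V) : set (quoV f) := quo f @` R.

Definition ears_rank (R : set V) : nat := \dim (vspan (ears_bar R)).

Definition ears_reduced (R : set V) : Prop :=
  forall a, ears_bar R a -> a != 0 -> ~ ears_bar R (2 *: a).

Record is_dot (R Rd : set V) : Prop := IsDot {
  dot_sub : Rd `<=` R;
  dot_frs : finite_root_system Rd;
  dot_image : quo f @` Rd = ears_bar R;
  dot_isometric : forall x y, Rd x -> Rd y ->
    quo_form f (quo f x) (quo f y) = f x y;
  dot_sum : (vspan Rd + radical f)%VS = {:V}%VS;
  dot_direct : (vspan Rd :&: radical f)%VS = 0%VS }.

End RootSystems.

Arguments ears_bar [K V] f R _.

(* Isomorphism of root systems [S] and [S'] spanning [U] and [U']. *)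
Definition root_iso (K : fieldType) (U U' : vectType K)
    (g : U -> U -> K) (g' : U' -> U' -> K) (S : set U) (S' : set U') : Prop :=
  exists phi : 'Hom(U, U'), [/\ bijective phi, phi @` S = S' &
    forall a b, S a -> S b ->
      g' (phi b) (coroot g' (phi a)) = g b (coroot g a)].

(* The type of an irreducible finite root system is its isomorphism class. *)
Definition same_type (K : realType) (V V' : vectType K)
    (f : {symmetric V}) (f' : {symmetric V'}) (R : set V) (R' : set V') : Prop :=
  root_iso (quo_form f) (quo_form f') (ears_bar f R) (ears_bar f' R').

Definition same_rank_nullity_type (K : realType) (V V' : vectType K)
    (f : {symmetric V}) (f' : {symmetric V'}) (R : set V) (R' : set V') : Prop :=
  [/\ ears_rank f R = ears_rank f' R', nullity f = nullity f'
    & same_type f f' R R'].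

(** * The extended affine Weyl group *)

Definition subgroup_GL (K : fieldType) (U : vectType K) (H : set 'End(U)) : Prop :=
  [/\ forall g, H g -> lker g == 0%VS, H \1%VF,
      forall g h, H g -> H h -> H (g \o h)%VF &
      forall g, H g -> H (g^-1)%VF].

Section WeylGroup.
Variables (K : realType) (V : vectType K) (f : {symmetric V}).

(* [V] being the internal direct sum of [vspan Rd] and [radical f], the space
   [tildeV] is [V] plus the dual of [radical f]; it does not depend on [Rd], but
   the pairing between [V] and this dual does. *)
Definition tildeV : vectType K := (V * 'Hom(subvs_of (radical f), K^o))%type.

Definition tilde_inj (v : V) : tildeV := (v, 0).

Variable Rd : set V.

Definition radical_part (v : V) : subvs_of (radical f) :=
  vsproj (radical f) (daddv_pi (radical f) (vspan Rd) v).

Definition tilde_form (x y : tildeV) : K :=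
  f x.1 y.1 + (y.2 (radical_part x.1) : K) + (x.2 (radical_part y.1) : K).

Fact radical_part_linear : linear radical_part.
Proof. by move=> a u v; rewrite /radical_part !linearP. Qed.

Fact tilde_form_sym x y :
  tilde_form x y = (-1) ^+ false * idfun (tilde_form y x).
Proof.
rewrite mul1r /= /tilde_form [f y.1 x.1]hermC /= mul1r.
by rewrite addrAC.
Qed.

Fact tilde_form_bilinear :
  @bilinear_for K tildeV tildeV K *%R (idfun \; *%R) tilde_form.
Proof.
have L y : linear_for *%R (tilde_form^~ y).
  move=> a u v; rewrite /tilde_form /= radical_part_linear linearPl linearP /=.
  rewrite add_lfunE scale_lfunE /= /GRing.scale /=; ring.
split=> // x a u v; rewrite tilde_form_sym mul1r /= L.
by rewrite [tilde_form u x]tilde_form_sym [tilde_form v x]tilde_form_sym !mul1r.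
Qed.

HB.instance Definition _ := bilinear_isBilinear.Build K tildeV tildeV K
  *%R (idfun \; *%R) tilde_form tilde_form_bilinear.

HB.instance Definition _ := isHermitianSesquilinear.Build K tildeV
  false idfun tilde_form tilde_form_sym.

Definition weyl_refl (a : V) : 'End(tildeV) :=
  linfun (refl tilde_form (tilde_inj a)).

Lemma weyl_reflE a x : weyl_refl a x = refl tilde_form (tilde_inj a) x.
Proof.
have L : linear (refl tilde_form (tilde_inj a)).
  move=> c u v; rewrite /refl linearPl scalerDl scalerBr scalerA.
  by rewrite opprD addrACA.
pose g : {linear tildeV -> tildeV} := HB.pack (refl tilde_form (tilde_inj a))
  (GRing.isLinear.Build _ _ _ _ _ L).
by rewrite /weyl_refl (lfunE g).
Qed.

Definition weyl (A : set V) : set 'End(tildeV) :=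
  smallest (@subgroup_GL K tildeV) (weyl_refl @` A).

(* [weyl A] applied to [A], as a subset of [V]. *)
Definition weyl_orbit (A : set V) : set V :=
  [set v | exists w, exists2 a, A a & weyl A w /\ w (tilde_inj a) = tilde_inj v].

Variable R : set V.

Definition reflectable (P : set V) : Prop :=
  weyl_orbit P = nonisotropic f R.

Definition class_Mm (P : set V) : Prop :=
  [/\ P `<=` nonisotropic f R, weyl P = weyl (nonisotropic f R) &
    forall Q : set V, Q `<=` P -> weyl Q = weyl (nonisotropic f R) -> Q = P].

Definition generating_number (n : nat) : Prop :=
  exists T : set 'End(tildeV), [/\ T `<=` weyl_refl @` nonisotropic f R,
    (T #= `I_n)%card & smallest (@subgroup_GL K tildeV) T = weyl (nonisotropic f R)].

Definition class_Mc (P : set V) : Prop :=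
  [/\ P `<=` nonisotropic f R, weyl P = weyl (nonisotropic f R) &
    exists c : nat, [/\ generating_number c,
      forall n, generating_number n -> (c <= n)%N & (P #= `I_c)%card]].

Definition sub_nonisotropic (P : set V) : set V := weyl_orbit P.

Definition sub_isotropic (P : set V) : set V :=
  [set a - b | a in sub_nonisotropic P & b in sub_nonisotropic P]
    `&` isotropic f R.

Definition sub_ears (P : set V) : set V :=
  sub_nonisotropic P `|` sub_isotropic P.

End WeylGroup.

Arguments isotropic [K V] f R _.
Arguments nonisotropic [K V] f R _.
Arguments restr_form [K V] f U x y.
Arguments weyl [K V] f Rd A _.
Arguments weyl_orbit [K V] f Rd A _.
Arguments sub_nonisotropic [K V] f Rd P _.
Arguments sub_isotropic [K V] f Rd R P _.
Arguments sub_ears [K V] f Rd R P _.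

(* Main.v *)
Require Import Defs.
From HB Require Import structures.
From mathcomp Require Import all_boot all_order all_algebra.
From mathcomp Require Import sesquilinear ring.
From mathcomp Require Import boolp classical_sets functions cardinality reals.

(** A Weyl group element generated by reflections in a set [P] of nonisotropic
    vectors is a word in these reflections, and on [V] the reflections of the
    hyperbolic extension act as those of [V].  The orbit of [P] is therefore
    described by words of reflections of [V], and the reflection in an element
    of the orbit is conjugate to a reflection in [P] ([weyl_refl_orbit]); hence
    the orbit is stable under its own reflections and generates the same group
    as [P].

    (i) The form being semidefinite, its radical is the set of isotropic
    vectors, so restricting it to a subspace is harmless.  Integrality, the
    behaviour of isotropic roots and the absence of doubled roots are inherited
    from [R].  The subgroup generated by the new roots is a full lattice in its
    span because the subgroups of a lattice have bases
    ([subgroup_free_basis]).  The orbit is connected because a vector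
    orthogonal to [P] is fixed by the whole group ([form_connected_orbit]).

    (ii) Suppose that [P] generates the whole Weyl group.  Every reflection in a
    root [a] is a word in reflections of [P]; evaluating it at [a] shows that
    [a] lies in the span of [P], so [P] spans [V] and rank and nullity do not
    change.  The type does not change either because the image of the orbit in
    the quotient by the radical is the set of all nonzero roots there: this is
    the fact that the reflections of a finite reflection group are those in its
    roots.  It is obtained from a product of linear forms.  Let [Psi] be the set
    of nonzero roots of the quotient outside the image of the orbit, and [q] the
    product of the linear forms attached to [Psi], one for each pair of opposite
    roots.  A reflection in [P] permutes [Psi] up to signs, so it maps [q] to
    [q] or to its opposite, and it is [q] since some point of the mirror lies
    off the zeros of [q] ([prod_form_refl]).  Thus [q] is invariant under the
    Weyl group, but the reflection in an element of [Psi] changes its sign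
    ([refl_not_word]).

    (iii) The isotropic roots of [R] are the isotropic differences of
    nonisotropic ones, so they are recovered from the orbit. *)

Set Implicit Arguments.
Unset Strict Implicit.
Unset Printing Implicit Defensive.

Import Order.TTheory GRing.Theory Num.Theory.

Local Open Scope classical_set_scope.
Local Open Scope ring_scope.

(** * Reflections *)

Section Reflections.
Variables (K : fieldType) (U : vectType K) (g : {symmetric U}).

Lemma sformC x y : g x y = g y x.
Proof. by rewrite hermC expr0 mul1r. Qed.

Lemma sformZl c x y : g (c *: x) y = c * g x y.
Proof. by rewrite linearZl_LR. Qed.

Lemma sformZr c x y : g x (c *: y) = c * g x y.
Proof. by rewrite sformC sformZl sformC. Qed.

Lemma sformDl x y z : g (x + y) z = g x z + g y z.
Proof. exact: linearDl. Qed.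

Lemma sformDr x y z : g x (y + z) = g x y + g x z.
Proof. exact: linearDr. Qed.

Lemma sformNl x y : g (- x) y = - g x y.
Proof. exact: linearNl. Qed.

Lemma sformNr x y : g x (- y) = - g x y.
Proof. exact: linearNr. Qed.

Lemma sformBl x y z : g (x - y) z = g x z - g y z.
Proof. exact: linearBl. Qed.

Lemma sformBr x y z : g x (y - z) = g x y - g x z.
Proof. exact: linearBr. Qed.

Lemma sform0l x : g 0 x = 0.
Proof. exact: linear0l. Qed.

Lemma form_coroot a x : g x (coroot g a) = 2 / g a a * g x a.
Proof. exact: sformZr. Qed.

Lemma reflE a x : refl g a x = x - (2 / g a a * g x a) *: a.
Proof. by rewrite /refl form_coroot. Qed.

Lemma refl_linear a : linear (refl g a).
Proof.
move=> c x y; rewrite !reflE sformDl sformZl scalerBr scalerA addrACA -opprD.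
by rewrite -scalerDl; congr (_ - _ *: _); ring.
Qed.

Lemma reflD a x y : refl g a (x + y) = refl g a x + refl g a y.
Proof. by rewrite -[x]scale1r refl_linear !scale1r. Qed.

Lemma refl0 a : refl g a 0 = 0.
Proof. by rewrite reflE sform0l mulr0 scale0r subr0. Qed.

Lemma reflZ a c x : refl g a (c *: x) = c *: refl g a x.
Proof. by rewrite -[c *: x]addr0 refl_linear refl0 addr0. Qed.

Lemma reflN a x : refl g a (- x) = - refl g a x.
Proof. by rewrite -scaleN1r reflZ scaleN1r. Qed.

Lemma reflB a x y : refl g a (x - y) = refl g a x - refl g a y.
Proof. by rewrite reflD reflN. Qed.

Lemma reflNl a x : refl g (- a) x = refl g a x.
Proof.
rewrite !reflE sformNl !sformNr opprK.
by rewrite mulrN scaleNr scalerN opprK.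
Qed.

Lemma refl_orthogonal a x : g x a = 0 -> refl g a x = x.
Proof. by move=> xa; rewrite reflE xa mulr0 scale0r subr0. Qed.

Lemma refl_self a : g a a != 0 -> refl g a a = - a.
Proof.
move=> a0; rewrite reflE divfK // scalerDl scale1r opprD addrA subrr.
by rewrite add0r.
Qed.

Lemma reflK a : g a a != 0 -> involutive (refl g a).
Proof.
move=> a0 x; rewrite (reflE a x) reflB reflZ refl_self // scalerN opprK.
by rewrite reflE addrNK.
Qed.

Lemma form_refl a x y : g (refl g a x) y = g x (refl g a y).
Proof.
rewrite !reflE sformBl sformZl sformBr sformZr (sformC a y).
by congr (_ - _); ring.
Qed.

Lemma refl_isometry a x y : g a a != 0 ->
  g (refl g a x) (refl g a y) = g x y.
Proof. by move=> a0; rewrite form_refl reflK. Qed.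

Lemma refl_conj a b x : g b b != 0 ->
  refl g (refl g b a) x = refl g b (refl g a (refl g b x)).
Proof.
move=> b0; rewrite (reflE a) reflB reflZ reflK // reflE.
by rewrite refl_isometry // form_refl.
Qed.

End Reflections.

(** * Reflections in a group generated by reflections *)

Section GenericPoints.
Variables (K : realFieldType) (U : vectType K) (g : {symmetric U}).
Hypothesis g_definite : forall x, g x x = 0 -> x = 0.

Lemma exists_notin (s : seq K) : exists t, t \notin s.
Proof.
exists (1 + \sum_(x <- s) `|x|); apply/negP => s_in.
have: `|1 + \sum_(x <- s) `|x| | <= \sum_(x <- s) `|x|.
  rewrite [leRHS](big_rem _ s_in) /= lerDl.
  by apply: sumr_ge0.
have s_ge0 : 0 <= \sum_(x <- s) `|x| by apply: sumr_ge0.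
rewrite ger0_norm ?addr_ge0 //.
by rewrite gerDr ler10.
Qed.

(** By induction on [s]: a solution for the tail is moved along the component of
    the new vector [b] orthogonal to [c], which is not orthogonal to [b], by a
    scalar avoiding the finitely many values that make some factor vanish. *)
Lemma exists_generic_orthogonal (c : U) (s : seq U) :
    (forall b, b \in s -> forall k, b != k *: c) ->
  exists2 x, g c x = 0 & forall b, b \in s -> g b x != 0.
Proof.
elim: s => [|b s IHs] s_c; first by exists 0; rewrite // sformC sform0l.
have [|x cx sx] := IHs; first by move=> d ds; apply: s_c; rewrite inE ds orbT.
pose y := b - (g b c / g c c) *: c.
have cy : g c y = 0.
  rewrite /y sformBr sformZr (sformC g b c).
  have [/g_definite->|cc] := eqVneq (g c c) 0.
    by rewrite !sform0l mulr0 subrr.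
  by rewrite divfK // subrr.
have by0 : g b y != 0.
  have -> : g b y = g y y.
    by rewrite {2}/y sformBl sformZl cy mulr0 subr0.
  apply/eqP => /g_definite/eqP; rewrite subr_eq0.
  by apply/negP/s_c; rewrite mem_head.
have [t] := exists_notin [seq - g d x / g d y | d <- b :: s].
move=> /mapP t_avoid; exists (x + t *: y).
  by rewrite sformDr sformZr cx cy mulr0 addr0.
move=> d ds; rewrite sformDr sformZr.
have [dy|dy] := eqVneq (g d y) 0.
  rewrite dy mulr0 addr0; apply: sx; move: ds.
  by rewrite inE => /predU1P[db|//]; rewrite -db dy eqxx in by0.
rewrite addrC addr_eq0; apply/eqP => td; apply: t_avoid; exists d => //.
by rewrite -td mulfK.
Qed.

(** The reflection permutes [s] up to signs, so it multiplies the product by a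
    constant [1] or [-1].  No factor vanishes identically on the mirror of [c],
    so the product is nonzero at some point of the mirror; that point being
    fixed, the constant is [1]. *)
Lemma prod_form_refl (c : U) (s : seq U) :
    c != 0 -> uniq s -> (forall b, b \in s -> - b \notin s) ->
    (forall b, b \in s -> refl g c b \in s \/ - refl g c b \in s) ->
    (forall b, b \in s -> forall k, b != k *: c) ->
  forall x, \prod_(b <- s) g b (refl g c x) = \prod_(b <- s) g b x.
Proof.
move=> c0 s_uniq sN s_refl s_c.
have cc : g c c != 0 by apply: contraNneq c0 => /g_definite ->.
pose e b : K := if refl g c b \in s then 1 else -1.
pose h b : U := if refl g c b \in s then refl g c b else - refl g c b.
have h_in b : b \in s -> h b \in s.
  move=> bs; rewrite /h; case: ifP => // rb.
  by case: (s_refl b bs); rewrite ?rb.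
have h_inj : {in s &, injective h}.
  have inj_r := can_inj (reflK cc).
  move=> a b /[dup] sa /sN aN /[dup] sb /sN bN; rewrite /h.
  case: ifP => _; case: ifP => _.
  - exact: inj_r.
  - by rewrite -reflN => /inj_r ab; rewrite -ab sa in bN.
  - by rewrite -reflN => /inj_r ab; rewrite ab sb in aN.
  - by move=> /oppr_inj/inj_r.
have h_perm : perm_eq [seq h b | b <- s] s.
  have hs_uniq : uniq [seq h b | b <- s] by rewrite map_inj_in_uniq.
  apply: uniq_perm => //.
  have hs : {subset [seq h b | b <- s] <= s}.
    by move=> _ /mapP[b bs ->]; exact: h_in.
  by have [] := uniq_min_size hs_uniq hs; rewrite ?size_map.
have sgn x : \prod_(b <- s) g b (refl g c x) =
    \prod_(b <- s) e b * \prod_(b <- s) g b x.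
  rewrite -[X in _ * X](perm_big _ h_perm) big_map -big_split /=.
  apply: eq_bigr => b _; rewrite -form_refl /e /h.
  by case: ifP => _; rewrite ?mul1r // sformNl mulN1r opprK.
have [x cx sx] := exists_generic_orthogonal s_c.
(* On the mirror of [c] both sides agree and do not vanish. *)
have e1 : \prod_(b <- s) e b = 1.
  have px : \prod_(b <- s) g b x != 0.
    by rewrite prodf_seq_neq0; apply/allP => b bs; exact: sx.
  apply: (mulIf px); rewrite mul1r -sgn refl_orthogonal //.
  by rewrite sformC.
by move=> y; rewrite sgn e1 mul1r.
Qed.

(** Choose one vector in each pair of opposite elements of [Psi], and let [q] be
    the product of the corresponding linear forms.  By [prod_form_refl], [q] is
    invariant under the reflections in [s], hence under the one in [a].  The
    same lemma, applied to the factors of [q] other than that of [a], shows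
    that the reflection in [a] changes the sign of [q].  As [q] is not the zero
    function, this is absurd. *)
Lemma refl_not_word (Psi : set U) (a : U) (s : seq U) :
    finite_set Psi -> ~ Psi 0 -> (forall b, Psi b -> Psi (- b)) ->
    (forall c, c \in s -> c != 0) ->
    (forall c b, c \in s -> Psi b -> Psi (refl g c b)) ->
    (forall c b k, c \in s -> Psi b -> b != k *: c) ->
    Psi a -> (forall k, Psi (k *: a) -> k = 1 \/ k = -1) ->
    (forall x, refl g a x = foldr (refl g) x s) -> False.
Proof.
move=> /finite_seqP[t tE] Psi0 PsiN s0 s_Psi s_prop + a_red a_word.
(* Replacing [a] by [- a] if needed, [a] is positive at a point [x] lying on no
   mirror of [Psi]. *)
wlog: a a_red a_word / exists2 x, 0 < g a x & forall b, Psi b -> g b x != 0.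
  move=> W aPsi.
  have [b tb k|x _ tx] := @exists_generic_orthogonal 0 t.
    by rewrite scaler0; apply/eqP => b0; apply: Psi0; rewrite tE /= -b0.
  have Psix b : Psi b -> g b x != 0 by rewrite tE; exact: tx.
  have [ax|ax|/esym ax0] := ltrgt0P (g a x); last first.
  - by have := Psix _ aPsi; rewrite ax0 eqxx.
  - apply: (W (- a)); last exact: PsiN.
    + move=> k; rewrite scalerN -scaleNr => /a_red[] /eqP.
        by rewrite eqr_oppLR => /eqP->; right.
      by rewrite eqr_opp => /eqP->; left.
    + by move=> y; rewrite reflNl.
    + by exists x => //; rewrite sformNl oppr_gt0.
  - by apply: (W a) => //; exists x.
move=> [x ax Psix] aPsi.
(* The representatives are the vectors of [Psi] on the positive side of [x]. *)
pose pos := [seq b <- undup t | 0 < g b x].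
have posP b : b \in pos <-> Psi b /\ 0 < g b x.
  by rewrite mem_filter mem_undup tE /=; split=> [/andP[]|[-> ->]].
have pos_uniq : uniq pos by rewrite filter_uniq ?undup_uniq.
have posN b : b \in pos -> - b \notin pos.
  move=> /posP[_ bx]; apply/negP => /posP[_]; rewrite sformNl oppr_gt0.
  by move=> /(lt_trans bx); rewrite ltxx.
have pos_or b : Psi b -> b \in pos \/ - b \in pos.
  move=> bPsi; have [bx|bx|bx] := ltrgt0P (g b x).
  - by left; apply/posP.
  - by right; apply/posP; split; [exact: PsiN|rewrite sformNl oppr_gt0].
  - by have := Psix _ bPsi; rewrite bx eqxx.
pose q y := \prod_(b <- pos) g b y.
have qs y : q (foldr (refl g) y s) = q y.
  elim: (s) s0 s_Psi s_prop => // c r IHr r0 r_Psi r_prop /=.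
  rewrite /q prod_form_refl //; last 3 first.
  - by apply: r0; rewrite mem_head.
  - by move=> b /posP[bPsi _]; apply/pos_or/r_Psi; rewrite ?mem_head.
  - by move=> b /posP[bPsi _] k; apply: r_prop; rewrite ?mem_head.
  have sub_r d : d \in r -> d \in c :: r by rewrite inE orbC => ->.
  apply: IHr => [d /sub_r/r0 //|d b /sub_r|d b k /sub_r]; first exact: r_Psi.
  exact: r_prop.
have a_pos : a \in pos by apply/posP.
have a0 : a != 0 by apply/eqP => a0; apply: Psi0; rewrite -a0.
have aa : g a a != 0 by apply: contraNneq a0 => /g_definite ->.
have Psi_a b : Psi b -> Psi (refl g a b).
  rewrite a_word; elim: (s) s_Psi => //= c r IHr r_Psi bPsi.
  apply: (r_Psi); rewrite ?mem_head //; apply: IHr => // d e dr.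
  by apply: r_Psi; rewrite inE dr orbT.
have rem_pos b : b \in rem a pos = (b != a) && (b \in pos).
  exact: mem_rem_uniq.
have qa y : q (refl g a y) = - q y.
  rewrite /q !(big_rem _ a_pos) /=.
  rewrite -form_refl refl_self // sformNl mulNr; congr (- (_ * _)).
  rewrite prod_form_refl ?rem_uniq //.
  - move=> b; rewrite rem_pos => /andP[ba /posN bN].
    by rewrite rem_pos negb_and bN orbT.
  - move=> b; rewrite !rem_pos => /andP[ba b_pos].
    have /posP[bPsi _] := b_pos.
    have ra_neq d : refl g a b = d -> b = refl g a d.
      by move=> <-; rewrite reflK.
    have [rb|rb] := pos_or _ (Psi_a _ bPsi); [left|right]; rewrite rb andbT.
      apply/eqP => /ra_neq; rewrite refl_self // => bE.
      by have /negP := posN _ a_pos; apply; rewrite -bE.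
    rewrite eqr_oppLR; apply/eqP => /ra_neq; rewrite reflN refl_self // opprK.
    by apply/eqP.
  - move=> b; rewrite rem_pos => /andP[ba b_pos] k; apply/eqP => bE.
    have /posP[+ _] := b_pos; rewrite bE => /a_red[] k1; move: ba b_pos.
      by rewrite bE k1 scale1r eqxx.
    by rewrite bE k1 scaleN1r => _ /posN; rewrite opprK a_pos.
have qx : 0 < q x.
  rewrite /q big_seq_cond; apply: prodr_gt0 => b; rewrite andbT.
  by move=> /posP[].
have := qs x; rewrite -a_word qa => /eqP; rewrite eq_sym -subr_eq0 opprK.
by rewrite gt_eqF // addr_gt0.
Qed.

End GenericPoints.

(** * Subgroups of lattices *)

Section ZSpan.
Variables (U : zmodType).
Implicit Types A L : set U.

Lemma subgroup_add L x y : additive_subgroup L -> L x -> L y -> L (x + y).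
Proof.
move=> [L0 LB] Lx Ly; rewrite -[y]opprK; apply: (LB) => //.
by rewrite -sub0r; exact: LB.
Qed.

Lemma subgroup_mulz L x m : additive_subgroup L -> L x -> L (x *~ m).
Proof.
move=> Lsub Lx; have LN y : L y -> L (- y).
  by rewrite -sub0r; apply: Lsub.2; exact: Lsub.1.
have Ln n : L (x *+ n).
  by elim: n => [|n IHn]; [exact: Lsub.1|rewrite mulrS; exact: subgroup_add].
by case: m => n; [rewrite -pmulrn|rewrite NegzE mulrNz -pmulrn; apply: LN].
Qed.

Lemma sub_zspan A : A `<=` zspan A.
Proof. exact: sub_gen_smallest. Qed.

Lemma zspan_subgroup A : additive_subgroup (zspan A).
Proof.
split=> [L [[L0 _] _] //|x y Ax Ay L LA].
by apply: LA.1.2; [exact: Ax|exact: Ay].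
Qed.

Lemma zspan_sub A L : additive_subgroup L -> A `<=` L -> zspan A `<=` L.
Proof. by move=> Lsub; exact: smallest_sub. Qed.

End ZSpan.

Lemma int_subgroup_cyclic (H : set int) :
  additive_subgroup H -> exists2 d, H d & forall m, H m -> (d %| m)%Z.
Proof.
move=> Hsub; have [[n nP]|none] := pselect (exists n, `[< H n.+1%:Z >]).
  case: (ex_minnP (ex_intro (fun n => `[< H n.+1%:Z >]) n nP)).
  move=> k /asboolP Hk k_min.
  exists k.+1%:Z => // m Hm; apply/dvdz_mod0P.
  have Hr : H (m %% k.+1)%Z.
    have -> : (m %% k.+1)%Z = m - k.+1%:Z *~ (m %/ k.+1)%Z.
      by rewrite {2}(divz_eq m k.+1) -mulrzr intz mulrC addrAC subrr add0r.
    by apply: Hsub.2 => //; exact: subgroup_mulz.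
  move: Hr; have := @ltz_pmod m k.+1 isT; have := @modz_ge0 m k.+1 isT.
  case: (m %% k.+1)%Z => // -[//|r] _ rk Hr; exfalso.
  have /k_min : `[< H r.+1%:Z >] by apply/asboolP.
  by rewrite leqNgt -ltnS -ltz_nat rk.
exists 0; first exact: Hsub.1.
move=> m Hm; rewrite dvd0z -absz_eq0; have : H `|m|%N%:Z.
  by rewrite abszEsg mulrC -[X in H (_ * X)]intz mulrzr; exact: subgroup_mulz.
case: `|m|%N => // k Hk; case: none; exists k; exact/asboolP.
Qed.

Section Lattices.
Variables (K : realType) (U : vectType K).

(** Coordinates with values in the integers bound the rank of [L], by induction
    on their number: the values of one of them on [L] form a cyclic group, and
    an element mapped to a generator, when that generator is nonzero,
    completes a basis of the part of [L] on which this coordinate vanishes.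
    The basis is free over the field because the functionals are linear over
    it. *)
Lemma subgroup_free_basis (I : eqType) (phi : I -> {scalar U}) (s : seq I)
    (L : set U) : additive_subgroup L ->
    (forall i x, i \in s -> L x -> phi i x \is a Num.int) ->
    (forall x, L x -> (forall i, i \in s -> phi i x = 0) -> x = 0) ->
  exists2 c : seq U, free c & L = zspan [set x | x \in c].
Proof.
elim: s L => [|i s IHs] L Lsub Lint L0.
  exists [::]; first exact: nil_free.
  apply/seteqP; split=> x; last first.
    by move: x; apply: zspan_sub.
  by move=> /L0-> //; exact: (zspan_subgroup _).1.
have phiZ y m : phi i (y *~ m) = phi i y *~ m by rewrite raddfMz.
pose L1 := L `&` [set x | phi i x = 0].
have [c c_free L1c] : exists2 c : seq U, free c & L1 = zspan [set x | x \in c].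
  apply: IHs.
  - split=> [|x y [Lx /= x0] [Ly /= y0]]; split=> /=.
    + exact: Lsub.1.
    + by rewrite raddf0.
    + exact: Lsub.2.
    + by rewrite raddfB /= x0 y0 subrr.
  - by move=> j x js [Lx _]; apply: Lint; rewrite // inE js orbT.
  - move=> x [Lx x0] xs; apply: L0 => // j; rewrite inE => /predU1P[->//|].
    exact: xs.
pose H := [set m : int | exists2 y, L y & phi i y = m%:~R].
have [d [y Ly yd] d_dvd] : exists2 d, H d & forall m, H m -> (d %| m)%Z.
  apply: int_subgroup_cyclic; split=> [|m n [x Lx xm] [y Ly yn]].
    by exists 0; [exact: Lsub.1|rewrite raddf0].
  by exists (x - y); [exact: Lsub.2|rewrite raddfB /= xm yn rmorphB].
have y_dvd x : L x -> exists m, L1 (x - y *~ m).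
  move=> Lx; have /intrP[n xn] := Lint i x (mem_head _ _) Lx.
  have /dvdzP[m nE] : (d %| n)%Z by apply: d_dvd; exists x.
  exists m; split; first by apply: Lsub.2 => //; exact: subgroup_mulz.
  by rewrite /= raddfB /= phiZ xn yd nE -[d%:~R *~ m]mulrzr -intrM mulrC subrr.
have [d0|d0] := eqVneq d 0.
  exists c => //; rewrite -L1c; apply/seteqP; split=> [x Lx|x []//].
  split=> //=; have [m [_ /=]] := y_dvd x Lx.
  by rewrite raddfB /= phiZ yd d0 mul0rz subr0.
have L1L x : x \in c -> L1 x.
  by move=> xc; rewrite L1c; exact: (@sub_zspan _ [set x | x \in c]).
exists (y :: c).
  rewrite free_cons c_free andbT.
  apply/negP => /(@coord_span _ _ _ (in_tuple c)) yc.
  move: d0; rewrite -(intr_eq0 K) -yd yc raddf_sum /= => /negP; apply.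
  rewrite big1 // => j _; rewrite linearZ /=.
  by have [_ /= ->] := L1L _ (mem_nth 0 (ltn_ord j)); rewrite mulr0.
apply/seteqP; split=> x.
  move=> /y_dvd[m L1x]; rewrite -[x](subrK (y *~ m)).
  apply: (subgroup_add (zspan_subgroup _)).
    move: L1x; rewrite L1c; move: (x - _); apply: zspan_sub.
      exact: zspan_subgroup.
    move=> z zc; apply: (@sub_zspan _ [set x | x \in y :: c]).
    by rewrite /= inE zc orbT.
  apply: (subgroup_mulz _ (zspan_subgroup _)).
  by apply: (@sub_zspan _ [set x | x \in y :: c]); rewrite /= mem_head.
by move: x; apply: zspan_sub => // z /=; rewrite inE => /predU1P[->//|/L1L[]].
Qed.

Lemma full_lattice_vspan (A : set U) :
  full_lattice (zspan A) -> vspan A = fullv.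
Proof.
move=> [b /andP[/eqP b_span _] bA]; apply/eqP; rewrite eqEsubv subvf /=.
rewrite -b_span; apply/span_subvP => x xb.
have : zspan A x by rewrite bA; exact: (@sub_zspan _ [set x | x \in b]).
apply: (@zspan_sub _ A [set x | x \in vspan A]); last exact: (vspanP A).1.
by split=> [|u v uA vA]; [exact: mem0v|exact: memvB].
Qed.

(** The coordinates in a basis of the lattice [L], pulled back along [h], are
    functionals to which [subgroup_free_basis] applies. *)
Lemma full_lattice_preimage (V : vectType K) (h : {linear U -> V})
    (L : set V) (A : set U) : injective h -> full_lattice L ->
    zspan A `<=` h @^-1` L -> vspan A = fullv ->
  full_lattice (zspan A).
Proof.
move=> h_inj [b b_basis ->] AL A_full.
have [c c_free cA] : exists2 c : seq U, free c &
    zspan A = zspan [set x | x \in c].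
  pose phi (i : 'I_(size b)) : {scalar U} := coord (in_tuple b) i \o h.
  apply: (@subgroup_free_basis _ phi (enum 'I_(size b))).
  - exact: zspan_subgroup.
  - move=> i x _ /AL; rewrite /phi /=; move: (h x).
    apply: (@zspan_sub _ _ [set v | coord (in_tuple b) i v \is a Num.int]).
      split=> [|u v /= ui vi]; first by rewrite /= raddf0.
      by rewrite /= raddfB /= rpredB.
    move=> v /= /(nthP 0)[j jb <-].
    have [j' <-] : exists j' : 'I_(size b), val j' = j by exists (Ordinal jb).
    have b_free := basis_free b_basis.
    by rewrite /= (@coord_free _ _ _ (in_tuple b) _ _ b_free) rpred_nat.
  - move=> x _ x0; apply: h_inj; rewrite linear0.
    have := @coord_basis _ _ _ _ (in_tuple b) _ b_basis (memvf (h x)).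
    move->; rewrite big1 // => i _.
    by rewrite [coord _ _ _]x0 ?scale0r ?mem_enum.
exists c => //; rewrite /basis_of c_free andbT eqEsubv subvf -A_full.
apply: (vspanP A).2 => x Ax; have : zspan A x by exact: sub_zspan.
rewrite cA; apply: (@zspan_sub _ _ [set x | x \in <<c>>%VS]).
  by split=> [|u v uA vA]; [exact: mem0v|exact: memvB].
by move=> y /=; exact: memv_span.
Qed.

End Lattices.

(** * Words in reflections *)

Section Words.
Variables (K : realType) (V : vectType K) (f : {symmetric V}) (Rd : set V).
Implicit Types (A : set V) (a b v : V) (s : seq V).

Local Notation tform := (tilde_form Rd : {symmetric (tildeV f)}).
Local Notation inj := (tilde_inj f).

Lemma tilde_form_inj a b : tform (inj a) (inj b) = f a b.
Proof. by rewrite /= /tilde_form /= !lfunE /= !addr0. Qed.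

Lemma weyl_refl_inj a v : weyl_refl f Rd a (inj v) = inj (refl f a v).
Proof.
rewrite weyl_reflE (reflE tform) !tilde_form_inj reflE /tilde_inj.
by congr (_, _); rewrite /= scaler0 subr0.
Qed.

Lemma weyl_refl_involutive a : f a a != 0 ->
  (weyl_refl f Rd a \o weyl_refl f Rd a)%VF = \1%VF.
Proof.
move=> aa; apply/lfunP => x; rewrite comp_lfunE !weyl_reflE id_lfunE.
by apply: (@reflK _ _ tform); rewrite tilde_form_inj.
Qed.

(** Conjugation by an isometry turns the reflection in [a] into the reflection
    in the image of [a]. *)
Lemma weyl_refl_conj a b : f b b != 0 -> weyl_refl f Rd (refl f b a) =
  (weyl_refl f Rd b \o weyl_refl f Rd a \o weyl_refl f Rd b)%VF.
Proof.
move=> bb; apply/lfunP => x; rewrite !comp_lfunE !weyl_reflE.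
have -> : inj (refl f b a) = refl tform (inj b) (inj a).
  by rewrite -weyl_refl_inj weyl_reflE.
by apply: (@refl_conj _ _ tform); rewrite tilde_form_inj.
Qed.

Definition weyl_word s : 'End(tildeV f) :=
  foldr (fun a w => weyl_refl f Rd a \o w)%VF \1%VF s.

Lemma weyl_word_inj s v : weyl_word s (inj v) = inj (foldr (refl f) v s).
Proof.
by elim: s => [|a s IHs] /=; rewrite ?id_lfunE // comp_lfunE IHs weyl_refl_inj.
Qed.

Lemma weyl_word_cat s t :
  weyl_word (s ++ t) = (weyl_word s \o weyl_word t)%VF.
Proof.
by elim: s => [|a s IHs] /=; rewrite ?comp_lfun1l // IHs comp_lfunA.
Qed.

Lemma weyl_word_rev s : (forall a, a \in s -> f a a != 0) ->
  (weyl_word (rev s) \o weyl_word s)%VF = \1%VF.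
Proof.
elim: s => [|a s IHs] s_ani; first exact: comp_lfun1l.
rewrite rev_cons -cats1 weyl_word_cat /= comp_lfun1r.
rewrite comp_lfunA -(comp_lfunA (weyl_word _)) weyl_refl_involutive.
  by rewrite comp_lfun1r IHs // => b bs; apply: s_ani; rewrite inE bs orbT.
by apply: s_ani; rewrite mem_head.
Qed.

Lemma sub_weyl A a : A a -> weyl f Rd A (weyl_refl f Rd a).
Proof. by move=> Aa; apply: sub_gen_smallest; exists a. Qed.

(** Reflections being involutions, the inverse of a word in them is the reversed
    word, so that words are closed under the group operations. *)
Lemma weylP A w : (forall a, A a -> f a a != 0) ->
  weyl f Rd A w <-> exists2 s, (forall a, a \in s -> A a) & w = weyl_word s.
Proof.
move=> A_ani; split.
  apply: (smallest_sub _ (X := [set w | exists2 s, (forall a, a \in s -> A a) &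
    w = weyl_word s])).
    have s_ani s : (forall a, a \in s -> A a) ->
        forall a, a \in s -> f a a != 0.
      by move=> sA a /sA/A_ani.
    have lker_word s : (forall a, a \in s -> A a) -> lker (weyl_word s) == 0%VS.
      move=> sA; apply/lker0P => x y xy.
      rewrite -[x]id_lfunE -[y]id_lfunE.
      by rewrite -(weyl_word_rev (s_ani _ sA)) !comp_lfunE xy.
    split.
    - by move=> _ [s sA ->]; exact: lker_word.
    - by exists [::].
    - move=> _ _ [s sA ->] [t tA ->]; exists (s ++ t); last first.
        by rewrite weyl_word_cat.
      by move=> a; rewrite mem_cat => /orP[/sA|/tA].
    - move=> _ [s sA ->]; exists (rev s) => [a|].
        by rewrite mem_rev => /sA.
      have ww := weyl_word_rev (s_ani _ sA).
      by rewrite -[RHS]comp_lfun1r -(lker0_compfV (lker_word _ sA)) comp_lfunA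
        ww comp_lfun1l.
  move=> _ [a Aa <-]; exists [:: a] => [b|]; first by rewrite inE => /eqP->.
  by rewrite /= comp_lfun1r.
case=> s + ->; elim: s => [|a s IHs] sA /= H [/[dup] Hgp [_ H1 HM _] AH] //.
apply: HM; first by apply: AH; exists a => //; apply: sA; rewrite mem_head.
by apply: IHs => // b bs; apply: sA; rewrite inE bs orbT.
Qed.

End Words.

(** * Positive semidefinite forms and their radical *)

Section Radical.
Variables (K : realType) (V : vectType K) (f : {symmetric V}).

Lemma quo_linear : linear (quo f).
Proof. by move=> c x y; rewrite /quo !linearP. Qed.

Lemma quoZ c x : quo f (c *: x) = c *: quo f x.
Proof. by rewrite /quo !linearZ. Qed.

Lemma quo_eq0 x : quo f x = 0 <-> x \in radical f.
Proof.
have q0 : quo f 0 = 0 by rewrite /quo !linear0.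
by rewrite -q0; have := quo_eq f x 0; rewrite subr0.
Qed.

Lemma quo_vsval (z : quoV f) : quo f (vsval z) = z.
Proof.
by rewrite /quo daddv_pi_id ?subvsP ?vsvalK // capvC capv_compl.
Qed.

Lemma vspan_ears_bar (A : set V) :
  vspan A = fullv -> vspan (ears_bar f A) = fullv.
Proof.
move=> A_full; apply/eqP; rewrite eqEsubv subvf; apply/subvP => z _.
have [x <-] := quo_surj z; have : x \in vspan A by rewrite A_full memvf.
move=> /mem_vspan[s sA /(@coord_span _ _ _ (in_tuple s))->].
rewrite /quo !linear_sum /=; apply: memv_suml => i _; rewrite !linearZ /=.
apply: memvZ; apply: (vspanP (ears_bar f A)).1.
by exists s`_i => //; apply: sA; exact: mem_nth.
Qed.

Lemma quo_refl a x :
  quo f (refl f a x) = refl (quo_form f) (quo f a) (quo f x).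
Proof.
rewrite (reflE f) (reflE (quo_form f)) !quo_formE addrC -scaleNr quo_linear.
by rewrite scaleNr addrC.
Qed.

Hypothesis f_psd : forall x, 0 <= f x x.

(** If [x] is isotropic and [f x y] is nonzero, then [f] takes arbitrarily
    negative values on the line through [y] of direction [x]. *)
Lemma mem_radical_psd x : x \in radical f <-> f x x = 0.
Proof.
split=> [/mem_radical->//|xx]; apply/mem_radical => y.
apply/eqP; apply: contraT => xy.
(* At this point of the line the form takes the value [-1]. *)
pose t := - ((f y y + 1) / (2 * f x y)); have := f_psd (t *: x + y).
rewrite !sformDl !sformDr !(sformZl, sformZr) xx (sformC f y x) !mulr0 add0r.
have -> : t * f x y + (t * f x y + f y y) = -1 by rewrite /t; field.
by rewrite oppr_ge0 ler10.
Qed.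

Lemma quo_definite z : quo_form f z z = 0 -> z = 0.
Proof.
by have [x <-] := quo_surj z; rewrite quo_formE => /mem_radical_psd/quo_eq0.
Qed.

End Radical.

(** * Orbits of connected sets of roots *)

Section Orbits.
Variables (K : realType) (V : vectType K) (f : {symmetric V}) (Rd P : set V).
Hypothesis P_anisotropic : forall a, P a -> f a a != 0.

Let O := weyl_orbit f Rd P.

Lemma weyl_orbitP v : O v <-> exists s a,
  [/\ forall b, b \in s -> P b, P a & v = foldr (refl f) a s].
Proof.
split=> [[w [a Pa [/(weylP _ _ P_anisotropic)[s sP ->]]]]|[s [a [sP Pa ->]]]].
  by rewrite weyl_word_inj => -[<-]; exists s, a.
exists (weyl_word f Rd s), a => //; split; last exact: weyl_word_inj.
by apply/weylP => //; exists s.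
Qed.

Lemma sub_weyl_orbit : P `<=` O.
Proof. by move=> a Pa; apply/weyl_orbitP; exists [::], a. Qed.

Lemma weyl_orbit_gen b v : P b -> O v -> O (refl f b v).
Proof.
move=> Pb /weyl_orbitP[s [a [sP Pa ->]]]; apply/weyl_orbitP.
by exists (b :: s), a; split=> // c; rewrite inE => /predU1P[->|/sP].
Qed.

Lemma weyl_orbit_ind (Q : V -> Prop) : (forall a, P a -> Q a) ->
  (forall b v, P b -> O v -> Q v -> Q (refl f b v)) -> forall v, O v -> Q v.
Proof.
move=> QP Qr v /weyl_orbitP[s [a [+ Pa ->]]]; elim: s => [|b s IHs] sP /=.
  exact: QP.
have sP' c : c \in s -> P c by move=> cs; apply: sP; rewrite inE cs orbT.
apply: Qr; [by apply: sP; rewrite mem_head| |exact: IHs].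
by apply/weyl_orbitP; exists s, a.
Qed.

Lemma weyl_orbit_anisotropic a : O a -> f a a != 0.
Proof.
move: a; apply: weyl_orbit_ind => // b v /P_anisotropic bb _ vv.
by rewrite refl_isometry.
Qed.

(** The reflection in an element of the orbit is conjugate, in the group, to the
    reflection in an element of [P]. *)
Lemma weyl_refl_orbit a : O a -> weyl f Rd P (weyl_refl f Rd a).
Proof.
move: a; apply: weyl_orbit_ind => [a|b v Pb _]; first exact: sub_weyl.
move=> /(weylP _ _ P_anisotropic)[s sP sE]; apply/weylP => //.
exists (b :: rcons s b); last first.
  by rewrite weyl_refl_conj ?P_anisotropic // sE -cats1 /= weyl_word_cat /=
    comp_lfun1r comp_lfunA.
by move=> c; rewrite inE mem_rcons inE orbA orbb => /predU1P[->|/sP].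
Qed.

Lemma weyl_orbit_refl a v : O a -> O v -> O (refl f a v).
Proof.
move=> /weyl_refl_orbit/(weylP _ _ P_anisotropic)[s sP sE] Ov.
have -> : refl f a v = foldr (refl f) v s.
  suff [] : tilde_inj f (refl f a v) = tilde_inj f (foldr (refl f) v s) by [].
  by rewrite -(weyl_refl_inj f Rd) sE weyl_word_inj.
elim: s sP {sE} => //= b s IHs sP; apply: weyl_orbit_gen.
  by apply: sP; rewrite mem_head.
by apply: IHs => c cs; apply: sP; rewrite inE cs orbT.
Qed.

Lemma weyl_weyl_orbit : weyl f Rd O = weyl f Rd P.
Proof.
apply/seteqP; split=> w.
  move=> /(weylP _ _ weyl_orbit_anisotropic)[s + ->].
  elim: s => [|a s IHs] sO; first by apply/weylP => //; exists [::].
  have [|t tP tE] := (weylP Rd (weyl_word f Rd s) P_anisotropic).1.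
    apply: IHs => c cs; apply: sO; rewrite inE cs orbT //.
  have [|r rP rE] := (weylP Rd (weyl_refl f Rd a) P_anisotropic).1.
    by apply: weyl_refl_orbit; apply: sO; rewrite mem_head.
  apply/weylP => //; exists (r ++ t); last by rewrite weyl_word_cat -rE -tE.
  by move=> c; rewrite mem_cat => /orP[/rP|/tP].
move=> /(weylP _ _ P_anisotropic)[s sP ->]; apply/weylP.
  exact: weyl_orbit_anisotropic.
by exists s => // a /sP/sub_weyl_orbit.
Qed.

(** In an orthogonal decomposition of the orbit, connectedness puts [P] on one
    side.  The other side is then fixed by all reflections in [P], so that its
    elements are in [P] themselves. *)
Lemma form_connected_orbit : form_connected f P -> form_connected f O.
Proof.
move=> P_conn.
suff key O1 O2 : O2 !=set0 -> O = O1 `|` O2 -> O1 `&` O2 = set0 ->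
    (forall x y, O1 x -> O2 y -> f x y = 0) -> ~ (P `<=` O1).
  move=> [O1 [O2 [O1n O2n OE O12 orth]]]; apply: P_conn.
  exists (P `&` O1), (P `&` O2); split.
  - apply/set0P/eqP => PO1; apply: (key O2 O1) => //.
    + by rewrite setUC.
    + by rewrite setIC.
    + by move=> x y xO yO; rewrite sformC orth.
    + move=> a Pa; have := sub_weyl_orbit Pa; rewrite OE => -[aO1|//].
      by have : (P `&` O1) a by []; rewrite PO1.
  - apply/set0P/eqP => PO2; apply: (key O1 O2) => // a Pa.
    have := sub_weyl_orbit Pa; rewrite OE => -[//|aO2].
    by have : (P `&` O2) a by []; rewrite PO2.
  - by rewrite -setIUr -OE; apply/esym/setIidl/sub_weyl_orbit.
  - by rewrite setIACA O12 setI0.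
  - by move=> x y [_ x1] [_ y2]; exact: orth.
move=> [v vO2] OE O12 orth PO1.
(* A vector of [O2] is fixed by every reflection in [P], hence lies in [P]. *)
have vO : O v by rewrite OE; right.
suff : O1 v by move=> vO1; have : (O1 `&` O2) v by []; rewrite O12.
move: v vO vO2; apply: weyl_orbit_ind => [a /PO1 //|b v Pb Ov IHv rO2].
suff rv : refl f b v = v by rewrite rv in rO2 *; exact: IHv.
rewrite -[RHS](reflK (P_anisotropic Pb)) [RHS]refl_orthogonal //.
by rewrite sformC; apply: orth => //; exact: PO1.
Qed.

End Orbits.

(** * The root system of a connected set of roots *)

Section SubEars.
Variables (K : realType) (V : vectType K) (f : {symmetric V}) (R : set V).
Hypothesis earsR : is_ears f R.
Variables (Rd P : set V).
Hypothesis P_sub : P `<=` nonisotropic f R.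

Let psd := ears_psd earsR.
Let O := weyl_orbit f Rd P.
Let S := sub_ears f Rd R P.
Let U := vspan S.
Let fU : {symmetric (subvs_of U)} := restr_form f U.
Let R' : set (subvs_of U) := vsval @^-1` S.

Lemma nonisotropicP a : nonisotropic f R a <-> R a /\ f a a != 0.
Proof.
split=> -[Ra aN]; split=> //.
  by apply/eqP => aa; apply: aN; apply/mem_radical_psd.
by move=> /mem_radical_psd - /(_ psd)/eqP; exact/negP.
Qed.

Lemma nonisotropic_refl a b :
  nonisotropic f R a -> nonisotropic f R b -> nonisotropic f R (refl f a b).
Proof.
move=> Na /nonisotropicP[Rb bb]; have /nonisotropicP[_ aa] := Na.
apply/nonisotropicP; split; first exact: ears_refl.
by rewrite refl_isometry.
Qed.

Lemma nonisotropic_opp a : nonisotropic f R a -> nonisotropic f R (- a).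
Proof.
move=> Na; have /nonisotropicP[_ aa] := Na.
by rewrite -(refl_self aa); exact: nonisotropic_refl.
Qed.

Lemma sub_anisotropic a : P a -> f a a != 0.
Proof. by move=> /P_sub/nonisotropicP[]. Qed.

Lemma weyl_orbit_nonisotropic : O `<=` nonisotropic f R.
Proof.
apply: (weyl_orbit_ind sub_anisotropic) => // b v /P_sub Nb _ Nv.
exact: nonisotropic_refl.
Qed.

Lemma weyl_orbit_opp a : O a -> O (- a).
Proof.
move=> Oa; rewrite -(refl_self (weyl_orbit_anisotropic sub_anisotropic Oa)).
exact: (weyl_orbit_refl sub_anisotropic).
Qed.

(** This form makes no reference to [R], as the axiom on isotropic roots
    requires: differences of elements of the orbit are differences of
    nonisotropic roots. *)
Lemma sub_isotropicE : sub_isotropic f Rd R P =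
  [set x | x \in radical f] `&` [set a - b | a in O & b in O].
Proof.
rewrite /sub_isotropic (ears_isotropic earsR) setIC -setIA.
congr (_ `&` _); apply/setIidr => _ [a Oa [b Ob <-]].
exists a; first exact: weyl_orbit_nonisotropic.
by exists b => //; exact: weyl_orbit_nonisotropic.
Qed.

Lemma sub_ears_sub : S `<=` R.
Proof. by move=> a [/weyl_orbit_nonisotropic[]|[_ []]]. Qed.

Lemma sub_ears_vspan x : S x -> x \in U.
Proof. exact: (vspanP S).1. Qed.

(** For a semidefinite form the radical consists of the isotropic vectors, so it
    is compatible with restriction to a subspace. *)
Lemma mem_radical_restr (x : subvs_of U) :
  x \in radical fU <-> vsval x \in radical f.
Proof.
have fU_psd y : 0 <= fU y y by exact: psd.
by split=> [/(mem_radical_psd fU_psd)|/(mem_radical_psd psd)] xx;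
  [apply/(mem_radical_psd psd)|apply/(mem_radical_psd fU_psd)].
Qed.

Lemma nonisotropic_restrP x : nonisotropic fU R' x <-> O (vsval x).
Proof.
split=> [[[//|[_ [_ xr]]]]|Ox]; first by case; exact/mem_radical_restr.
have [_ xN] := weyl_orbit_nonisotropic Ox.
by split; [left|move=> /mem_radical_restr].
Qed.

Lemma isotropic_restrP x :
  isotropic fU R' x <-> sub_isotropic f Rd R P (vsval x).
Proof.
split=> [[[/weyl_orbit_nonisotropic[_ xN]|//] xr]|xi].
  by case: xN; exact/mem_radical_restr.
by split; [right|apply/mem_radical_restr; have [_ []] := xi].
Qed.

Lemma vsval_image (A : set V) (B : set (subvs_of U)) :
  A `<=` S -> (forall x, B x <-> A (vsval x)) -> vsval @` B = A.
Proof.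
move=> AS BA; apply/seteqP; split=> [_ [x /BA Ax <-] //|v Av].
have vU : v \in U by apply: sub_ears_vspan; exact: AS.
by exists (vsproj U v); [apply/BA|]; rewrite vsprojK.
Qed.

Lemma restr_image_nonisotropic : vsval @` nonisotropic fU R' = O.
Proof. by apply: vsval_image; [move=> a; left|exact: nonisotropic_restrP]. Qed.

Lemma restr_image_isotropic :
  vsval @` isotropic fU R' = sub_isotropic f Rd R P.
Proof. by apply: vsval_image; [move=> a; right|exact: isotropic_restrP]. Qed.

Lemma restr_refl (a b : subvs_of U) :
  vsval (refl fU a b) = refl f (vsval a) (vsval b).
Proof. by rewrite (reflE fU) (reflE f) linearB linearZ. Qed.

Lemma vspan_restr : vspan R' = fullv.
Proof.
apply/eqP; rewrite eqEsubv subvf /=; apply/subvP => x _.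
have /mem_vspan[s sS xs] := subvsP x.
have sR' : {subset [seq vsproj U v | v <- s] <= vspan R'}.
  move=> _ /mapP[v /sS Sv ->]; apply: (vspanP R').1.
  by rewrite /R' /preimage /= vsprojK //; exact: sub_ears_vspan.
suff : x \in <<[seq vsproj U v | v <- s]>>%VS by apply/subvP/span_subvP.
rewrite -[x]vsvalK (@coord_span _ _ _ (in_tuple s) _ xs) linear_sum /=.
apply: memv_suml => i _; rewrite linearZ memvZ // memv_span //.
by apply: map_f; exact: mem_nth.
Qed.

(** Most axioms are inherited from [R]; stability under reflections,
    connectedness and the lattice property come from [weyl_orbit_refl],
    [form_connected_orbit] and [full_lattice_preimage]. *)
Lemma ears_restr : P !=set0 -> form_connected f P -> is_ears fU R'.
Proof.
move=> [p Pp] P_conn; split.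
- by move=> x; exact: psd.
- apply: (full_lattice_preimage (h := vsval) subvs_inj (ears_lattice earsR)).
    apply: zspan_sub => [|x Sx]; last by apply: sub_zspan; exact: sub_ears_sub.
    have [z0 zB] := zspan_subgroup R.
    split=> [|x y xz yz]; rewrite /preimage /= ?linearB ?linear0 //.
    exact: zB.
  exact: vspan_restr.
- move=> a b /nonisotropic_restrP Oa /nonisotropic_restrP Ob.
  rewrite (form_coroot fU) -(form_coroot f (vsval a) (vsval b)).
  by apply: (ears_int earsR); exact: weyl_orbit_nonisotropic.
- move=> a b /nonisotropic_restrP Oa Sb; change (S (vsval (refl fU a b))).
  rewrite restr_refl; case: Sb => [Ob|bi].
    by left; exact: (weyl_orbit_refl sub_anisotropic).
  right; rewrite refl_orthogonal //.
  by have [_ [_ /mem_radical]] := bi.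
- apply/seteqP; split=> x.
    move=> /isotropic_restrP; rewrite sub_isotropicE => -[xr [a Oa [b Ob xE]]].
    split; first exact/mem_radical_restr.
    move: Oa Ob; rewrite -restr_image_nonisotropic => -[a' Na aE] [b' Nb bE].
    exists a' => //; exists b' => //; apply: subvs_inj.
    by rewrite linearB /= aE bE.
  move=> [xr [a /nonisotropic_restrP Oa [b /nonisotropic_restrP Ob xE]]].
  apply/isotropic_restrP; rewrite sub_isotropicE; split.
    exact/mem_radical_restr.
  by exists (vsval a) => //; exists (vsval b) => //; rewrite -xE linearB.
- move=> a /nonisotropic_restrP Oa; change (~ S (vsval (2 *: a))).
  rewrite linearZ /= => /sub_ears_sub; apply: (ears_double earsR).
  exact: weyl_orbit_nonisotropic.
- have O_conn := form_connected_orbit (Rd := Rd) sub_anisotropic P_conn.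
  move=> [P1 [P2 [[x1 P1x] [x2 P2x] PE P12 orth]]]; apply: O_conn.
  exists (vsval @` P1), (vsval @` P2); split.
  + by exists (vsval x1), x1.
  + by exists (vsval x2), x2.
  + rewrite -[LHS]restr_image_nonisotropic -image_setU.
    by congr (_ @` _); exact: PE.
  + apply/seteqP; split=> // _ [[y P1y <-] [z P2z /subvs_inj zy]].
    by have : (P1 `&` P2) y; [split; rewrite // -zy|rewrite P12].
  + by move=> _ _ [y P1y <-] [z P2z <-]; exact: orth.
- have : O p := sub_weyl_orbit Rd sub_anisotropic Pp.
  by rewrite -restr_image_nonisotropic => -[x Nx _]; exists x.
Qed.

(** * Sets of roots generating the whole Weyl group *)

(** The Cartan integers of the two roots are [2 * k] and [2 / k], whose product
    is [4]; so [k] is, up to sign, [1], [2] or [1 / 2], and the last two values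
    contradict reducedness. *)
Lemma reduced_proportional a b k : ears_reduced f R ->
  nonisotropic f R a -> nonisotropic f R b -> quo f b = k *: quo f a ->
  k = 1 \/ k = -1.
Proof.
move=> red Na Nb bE; have /nonisotropicP[Ra aa] := Na.
have /nonisotropicP[Rb bb] := Nb.
have baE : f b a = k * f a a by rewrite -(quo_formE f b) bE sformZl quo_formE.
have bbE : f b b = k ^+ 2 * f a a.
  by rewrite -(quo_formE f b) bE sformZl sformZr quo_formE; ring.
have k0 : k != 0 by apply: contraNneq bb => k0; rewrite bbE k0 expr0n mul0r.
have /intrP[m mE] : 2 * k \is a Num.int.
  have -> : 2 * k = f b (coroot f a) by rewrite form_coroot baE; field.
  exact: (ears_int earsR).
have /intrP[n nE] : 2 / k \is a Num.int.
  have -> : 2 / k = f a (coroot f b).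
    by rewrite form_coroot (sformC f a) baE bbE; field; rewrite k0 aa.
  exact: (ears_int earsR).
have mn : m * n = 4.
  apply/eqP; rewrite -(eqr_int K) intrM -mE -nE; apply/eqP; field.
  exact: k0.
have m_div : `|m|%N \in divisors 4.
  rewrite -dvdn_divisors //; apply/dvdnP; exists `|n|%N.
  by rewrite mulnC -abszM mn.
have bar_neq0 c : nonisotropic f R c -> quo f c != 0.
  by move=> [_ cN]; apply/eqP => /quo_eq0.
have no_double c d :
    nonisotropic f R c -> nonisotropic f R d -> quo f d <> 2 *: quo f c.
  move=> Nc Nd dE; apply: (red (quo f c)); last first.
  - by rewrite -dE; exists d => //; have [] := Nd.
  - exact: bar_neq0.
  - by exists c => //; have [] := Nc.
have quoN c : quo f (- c) = - quo f c by rewrite -scaleN1r quoZ scaleN1r.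
have kE : k = m%:~R / 2 by rewrite -mE; field.
move: m_div; rewrite (_ : divisors 4 = [:: 1; 2; 4]%N) // !inE.
have aE : quo f a = k^-1 *: quo f b by rewrite bE scalerA mulVf // scale1r.
have Na' := nonisotropic_opp Na; have Nb' := nonisotropic_opp Nb.
(* The six cases are [m] equal to 1, 2, 4, -1, -2, -4, in this order. *)
case: m kE {mE mn} => m /= kE /or3P[] /eqP mE; move: kE.
all: rewrite ?NegzE mE => kE.
- by case: (no_double _ _ Nb Na); rewrite aE kE invf_div divr1.
- by left; rewrite kE; field.
- by case: (no_double _ _ Na Nb); rewrite bE kE; congr (_ *: _); field.
- case: (no_double _ _ Nb' Na); rewrite aE kE quoN scalerN -scaleNr.
  by rewrite mulrNz mulNr invrN invf_div divr1.
- by right; rewrite kE; field.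
- case: (no_double _ _ Na' Nb); rewrite bE kE quoN scalerN -scaleNr.
  by congr (_ *: _); field.
Qed.


Hypothesis weylE : weyl f Rd (nonisotropic f R) = weyl f Rd P.

Lemma refl_as_word a : nonisotropic f R a ->
  exists2 s, (forall b, b \in s -> P b) &
    forall v, refl f a v = foldr (refl f) v s.
Proof.
move=> Na; have : weyl f Rd P (weyl_refl f Rd a).
  by rewrite -weylE; exact: sub_weyl.
move=> /(weylP _ _ sub_anisotropic)[s sP sE]; exists s => // v.
suff [] : tilde_inj f (refl f a v) = tilde_inj f (foldr (refl f) v s) by [].
by rewrite -(weyl_refl_inj f Rd) sE weyl_word_inj.
Qed.

(** A word in the reflections of [P] moves every vector by an element of the
    span of [P], whereas the reflection in a root [a] moves [a] by [-2 * a]. *)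
Lemma vspan_generating : vspan P = fullv.
Proof.
have word_span s v : (forall b, b \in s -> P b) ->
    foldr (refl f) v s - v \in vspan P.
  elim: s => [|b s IHs] sP /=; first by rewrite subrr mem0v.
  rewrite reflE addrAC; apply: memvB.
    by apply: IHs => c cs; apply: sP; rewrite inE cs orbT.
  by apply: memvZ; apply: (vspanP P).1; apply: sP; rewrite mem_head.
have N_span a : nonisotropic f R a -> a \in vspan P.
  move=> /[dup] Na /refl_as_word[s sP sE]; have /nonisotropicP[_ aa] := Na.
  have := word_span s a sP; rewrite -sE refl_self // -opprD memvN.
  rewrite -mulr2n -scaler_nat => /(memvZ 2^-1).
  by rewrite scalerA mulVf ?pnatr_eq0 // scale1r.
have R_span : R `<=` [set x | x \in vspan P].
  move=> a Ra; have [ar|aN] := pselect (a \in radical f).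
    have : isotropic f R a by [].
    rewrite (ears_isotropic earsR) => -[_ [b Nb [c Nc <-]]] /=.
    by rewrite memvB ?N_span.
  exact: N_span.
apply/eqP; rewrite eqEsubv subvf -(full_lattice_vspan (ears_lattice earsR)).
exact: (vspanP R).2.
Qed.

Lemma vspan_sub_ears : U = fullv.
Proof.
apply/eqP; rewrite eqEsubv subvf -vspan_generating; apply: (vspanP P).2.
move=> a Pa; apply: sub_ears_vspan; left.
exact: (sub_weyl_orbit Rd sub_anisotropic).
Qed.

(** Otherwise the reflection in [a] would contradict [refl_not_word] in the
    quotient by the radical, for [Psi] the set of images of roots outside the
    image of the orbit.  Reducedness ensures that no element of [Psi] is a
    multiple of an element of [P]. *)
Lemma quo_orbit a : ears_reduced f R -> finite_set (ears_bar f R) ->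
  nonisotropic f R a -> (quo f @` O) (quo f a).
Proof.
move=> red fin Na; apply: contrapT => aO.
have quoN b : quo f (- b) = - quo f b by rewrite -scaleN1r quoZ scaleN1r.
pose Psi := (quo f @` nonisotropic f R) `\` (quo f @` O).
have [s0 s0P sE] := refl_as_word Na.
have sP z : z \in [seq quo f c | c <- s0] -> exists2 c, P c & z = quo f c.
  by move=> /mapP[c /s0P Pc ->]; exists c.
have PO c (Pc : P c) : O c := sub_weyl_orbit Rd sub_anisotropic Pc.
apply: (@refl_not_word _ _ (quo_form f) _ Psi (quo f a)
  [seq quo f c | c <- s0]).
- exact: quo_definite.
- apply: sub_finite_set fin => _ [[b [Rb _] <-] _]; by exists b.
- by move=> [[b [_ bN] /quo_eq0]].
- move=> _ [[b Nb <-] bO]; split.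
    by exists (- b); [exact: nonisotropic_opp|exact: quoN].
  move=> [c Oc cE]; apply: bO; exists (- c); first exact: weyl_orbit_opp.
  by rewrite quoN cE opprK.
- by move=> _ /sP[c /P_sub[_ cN] ->]; apply/eqP => /quo_eq0.
- move=> _ _ /sP[c Pc ->] [[b Nb <-] bO]; rewrite -quo_refl; split.
    by exists (refl f c b) => //; apply: nonisotropic_refl => //; exact: P_sub.
  move=> [d Od dE]; apply: bO; exists (refl f c d).
    by apply: (weyl_orbit_refl sub_anisotropic) => //; exact: PO.
  by rewrite quo_refl dE quo_refl reflK // quo_formE sub_anisotropic.
- move=> _ _ k /sP[c Pc ->] [[b Nb <-] bO]; apply/eqP => bE; apply: bO.
  have [] := reduced_proportional red (P_sub Pc) Nb bE => k1.
    by exists c; [exact: PO|rewrite bE k1 scale1r].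
  exists (- c); first by apply: weyl_orbit_opp; exact: PO.
  by rewrite bE k1 scaleN1r quoN.
- by split=> //; exists a.
- move=> k [[b Nb bE] _]; exact: (reduced_proportional red Na Nb bE).
- move=> z; have [v <-] := quo_surj z; rewrite -quo_refl sE.
  by elim: (s0) => //= c s IHs; rewrite quo_refl IHs.
Qed.

Lemma ears_bar_sub_ears : P !=set0 -> ears_reduced f R ->
  finite_set (ears_bar f R) -> quo f @` S = ears_bar f R.
Proof.
move=> [p Pp] red fin; apply/seteqP; split=> [_ [a Sa <-]|_ [a Ra <-]].
  by exists a => //; exact: sub_ears_sub.
have [ar|aN] := pselect (a \in radical f); last first.
  have [|b Ob bE] := quo_orbit red fin (a := a) _; first by [].
  by exists b => //; left.
have Op : O p := sub_weyl_orbit Rd sub_anisotropic Pp.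
(* Isotropic roots have the same image as [0], which is the difference [p - p]. *)
exists 0; last by apply/esym/quo_eq; rewrite subr0.
right; rewrite sub_isotropicE; split; first exact: mem0v.
by exists p => //; exists p => //; rewrite subrr.
Qed.

(** The quotients by the two radicals are identified by the map [phi] induced by
    the inclusion of [U], an isometry. *)
Lemma same_rank_nullity_type_restr :
  quo f @` S = ears_bar f R -> same_rank_nullity_type fU f R' R.
Proof.
move=> barE; have inU v : v \in U by rewrite vspan_sub_ears memvf.
have phi_linear : linear (fun z : quoV fU => quo f (vsval (vsval z))).
  by move=> c x y; rewrite !linearP quo_linear.
pose phi0 : {linear quoV fU -> quoV f} := HB.pack
  (fun z : quoV fU => quo f (vsval (vsval z)))
  (GRing.isLinear.Build _ _ _ _ _ phi_linear).
pose phi : 'Hom(quoV fU, quoV f) := linfun phi0.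
have phiE z : phi z = quo f (vsval (vsval z)) by rewrite /phi lfunE.
have phi_quo x : phi (quo fU x) = quo f (vsval x).
  rewrite phiE; apply/quo_eq; rewrite -linearB; apply/mem_radical_restr.
  by apply/quo_eq; exact: quo_vsval.
have phi_ker : lker phi = 0%VS.
  apply/eqP/lker0P => x y; rewrite !phiE => /quo_eq; rewrite -linearB.
  by move=> /mem_radical_restr/quo_eq; rewrite !quo_vsval.
have phi_surj y : exists z, phi z = y.
  have [v <-] := quo_surj y; exists (quo fU (vsproj U v)).
  by rewrite phi_quo vsprojK.
have phi_form a b : quo_form f (phi a) (phi b) = quo_form fU a b.
  have [x <-] := quo_surj a; have [y <-] := quo_surj b.
  by rewrite !phi_quo !quo_formE.
have phi_bar : phi @` ears_bar fU R' = ears_bar f R.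
  rewrite -barE; apply/seteqP; split=> [_ [_ [x R'x <-] <-]|_ [v Sv <-]].
    by exists (vsval x) => //; rewrite phi_quo.
  exists (quo fU (vsproj U v)); last by rewrite phi_quo vsprojK.
  by exists (vsproj U v) => //; rewrite /R' /preimage /= vsprojK.
have phi_img : (phi @: fullv)%VS = fullv.
  apply/eqP; rewrite eqEsubv subvf; apply/subvP => y _.
  by have [z <-] := phi_surj y; rewrite memv_img ?memvf.
split.
- rewrite /ears_rank !vspan_ears_bar; last 2 first.
  + exact: full_lattice_vspan (ears_lattice earsR).
  + exact: vspan_restr.
  by rewrite -phi_img limg_dim_eq // phi_ker capv0.
- rewrite /nullity; pose h := linfun (vsval : subvs_of U -> V).
  have hE x : h x = vsval x by rewrite /h lfunE.
  have h_ker : lker h = 0%VS.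
    by apply/eqP/lker0P => x y; rewrite !hE; exact: subvs_inj.
  rewrite -(limg_dim_eq (f := h)) ?h_ker ?capv0 //; congr (\dim _).
  apply/eqP; rewrite eqEsubv; apply/andP; split; apply/subvP => v.
    by move=> /memv_imgP[x /mem_radical_restr xr ->]; rewrite hE.
  move=> vr; rewrite -[v](@vsprojK _ _ U) // -hE; apply: memv_img.
  by apply/mem_radical_restr; rewrite vsprojK.
- exists phi; split=> //.
    exists (phi^-1)%VF; first by apply: lker0_lfunK; rewrite phi_ker.
    by move=> y; apply: limg_lfunVK; rewrite phi_img memvf.
  move=> a b _ _.
  by rewrite (form_coroot (quo_form f)) (form_coroot (quo_form fU)) !phi_form.
Qed.

End SubEars.

Theorem proposition3p1p6 (K : realType) (V : vectType K) (f : {symmetric V})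
    (R : set V) (earsR : is_ears f R) (reducedR : ears_reduced f R)
    (Rd : set V) (dotR : is_dot f R Rd)
    (P : set V) (P_neq0 : P !=set0) (P_sub : P `<=` nonisotropic f R)
    (P_conn : form_connected f P) :
  let W := weyl f Rd (nonisotropic f R) in
  let W_P := weyl f Rd P in
  let Rn_P := sub_nonisotropic f Rd P in
  let Ri_P := sub_isotropic f Rd R P in
  let R_P := sub_ears f Rd R P in
  let V_P : {vspace V} := vspan R_P in
  let f_P : {symmetric (subvs_of V_P)} := restr_form f V_P in
  let R_P' : set (subvs_of V_P) := vsval @^-1` R_P in
  [/\ [/\ is_ears f_P R_P',
        vsval @` nonisotropic f_P R_P' = Rn_P,
        vsval @` isotropic f_P R_P' = Ri_P &
        W_P = weyl f Rd (vsval @` nonisotropic f_P R_P')],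
      (W = W_P -> same_rank_nullity_type f_P f R_P' R) /\
      (class_Mc f Rd R P \/ class_Mm f Rd R P ->
        same_rank_nullity_type f_P f R_P' R) &
      reflectable f Rd R P -> R_P = R].
Proof.
move=> W W_P Rn_P Ri_P R_P V_P f_P R_P'.
have type_eq : W = W_P -> same_rank_nullity_type f_P f R_P' R.
  move=> WE; apply: (same_rank_nullity_type_restr earsR P_sub WE).
  apply: (ears_bar_sub_ears earsR P_sub WE P_neq0 reducedR).
  rewrite -(dot_image dotR); apply: finite_image.
  exact: (frs_finite (dot_frs dotR)).
split; first split.
- exact: ears_restr.
- exact: restr_image_nonisotropic.
- exact: restr_image_isotropic.
- rewrite (restr_image_nonisotropic earsR Rd P_sub).
  by apply/esym/weyl_weyl_orbit; exact: (sub_anisotropic earsR P_sub).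
- split=> //; case=> -[_ WE _]; apply: type_eq; exact: esym WE.
- rewrite /reflectable => refl_P.
  rewrite /R_P /sub_ears (sub_isotropicE earsR _ P_sub).
  rewrite /sub_nonisotropic refl_P -(ears_isotropic earsR).
  by rewrite setUC /isotropic /nonisotropic setUIDK.
Qed.
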